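(* For every $a>0$, $b\in(0,1)$ and $x\in(0,1)$ we have $$\lim_{n\to\infty}\frac1n\sum_{k=0}^{n-1}f_{a,b}^k(x)=b.$$
   Context: For real $a>0$ and $b\in(0,1)$, the map $f_{a,b}:[0,1]\to[0,1]$ is defined by $$f_{a,b}(x)=\frac{x}{x+(1-x)\exp(a(x-b))}.$$ $f_{a,b}^k$ denotes the $k$-th iterate of $f_{a,b}$ (with $f_{a,b}^0=\mathrm{id}$). *)

(* Defs.v *)
From mathcomp Require Import all_boot all_order all_algebra.
From mathcomp Require Import all_classical all_reals all_analysis.

Set Implicit Arguments.
Unset Strict Implicit.
Unset Printing Implicit Defensive.

Import Order.TTheory GRing.Theory Num.Theory.
Local Open Scope ring_scope.

(* The map is the restriction of [fab a b] to [0, 1]: there the denominator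
   is positive and the value lies in [0, 1], so iterates of points of [0, 1]
   never involve the values of [fab a b] outside [0, 1]. *)
Definition fab (R : realType) (a b x : R) : R :=
  x / (x + (1 - x) * expR (a * (x - b))).

Lemma fab_itv01 (R : realType) (a b x : R) :
  0 <= x -> x <= 1 -> 0 <= fab a b x /\ fab a b x <= 1.
Proof.
move=> x0 x1.
have y0 : 0 <= (1 - x) * expR (a * (x - b)).
  by rewrite mulr_ge0 ?subr_ge0 ?expR_ge0.
split; first by rewrite divr_ge0 ?addr_ge0.
have [->|xn0] := eqVneq x 0; first by rewrite /fab mul0r ler01.
have xp : 0 < x by rewrite lt_neqAle eq_sym xn0 x0.
by rewrite /fab ler_pdivrMr ?mul1r ?lerDl // ltr_wpDr.
Qed.

(* Main.v *)
Require Import Defs.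
From mathcomp Require Import all_boot all_order all_algebra.
From mathcomp Require Import all_classical all_reals all_analysis.
From mathcomp Require Import ring lra.

Import Order.TTheory GRing.Theory Num.Theory.
Import numFieldNormedType.Exports.
Local Open Scope classical_set_scope.
Local Open Scope ring_scope.

(** In the coordinate [y = ln ((1 - x) / x)] the map reads
    [y |-> y + a * (x - b)], so [a] times the sum of [x_k - b] over [k < n]
    telescopes to [y_n - y_0].  The orbit of [y] is bounded, because a step
    has length at most [a] and always points towards the coordinate of the
    fixed point [b].  Hence the averages differ from [b] by [O(1/n)]. *)

Definition neg_logit {R : realType} (x : R) : R := ln (1 - x) - ln x.

Lemma neg_logit_le (R : realType) (x y : R) :
  0 < x -> x <= y -> y < 1 -> neg_logit y <= neg_logit x.
Proof.
move=> x0 xy y1; rewrite /neg_logit.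
have h1 : ln x <= ln y by rewrite ler_ln // posrE; lra.
have h2 : ln (1 - y) <= ln (1 - x) by rewrite ler_ln ?posrE; lra.
lra.
Qed.

Section orbit.
Variables (R : realType) (a b : R).

Lemma fab_denom_gt0 (x : R) :
  0 < x -> x < 1 -> 0 < x + (1 - x) * expR (a * (x - b)).
Proof.
by move=> x0 x1; rewrite addr_gt0 // mulr_gt0 ?expR_gt0 ?subr_gt0.
Qed.

(** The denominator is that of [fab a b x] itself, so it cancels in the difference of logarithms
    [neg_logit (fab a b x)]. *)
Lemma fab_compl (x : R) : 0 < x -> x < 1 ->
  1 - fab a b x =
  (1 - x) * expR (a * (x - b)) / (x + (1 - x) * expR (a * (x - b))).
Proof.
move=> x0 x1; have d0 := lt0r_neq0 (fab_denom_gt0 x x0 x1).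
by rewrite /fab; field.
Qed.

(** Orbits must avoid 0 and 1, where one logarithm in [neg_logit] is only a default value. *)
Lemma fab_open01 (x : R) : 0 < x < 1 -> 0 < fab a b x < 1.
Proof.
move=> /andP[x0 x1]; have d0 := fab_denom_gt0 x x0 x1.
rewrite divr_gt0 //= -subr_gt0 fab_compl // divr_gt0 // mulr_gt0 ?expR_gt0 //.
by rewrite subr_gt0.
Qed.

Lemma neg_logit_fab (x : R) : 0 < x < 1 ->
  neg_logit (fab a b x) = neg_logit x + a * (x - b).
Proof.
move=> /andP[x0 x1]; have d0 := fab_denom_gt0 x x0 x1.
have y0 : 0 < 1 - x by rewrite subr_gt0.
rewrite /neg_logit fab_compl // /fab.
rewrite !ln_div ?posrE ?mulr_gt0 ?expR_gt0 // lnM ?posrE ?expR_gt0 // expRK.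
ring.
Qed.

Variable x : R.
Hypothesis x01 : 0 < x < 1.

Let orb k := iter k (fab a b) x.

Lemma iter_fab_open01 k : 0 < orb k < 1.
Proof. by elim: k => [//|k IH]; rewrite /orb iterS fab_open01. Qed.

Lemma neg_logit_iter_fab n :
  neg_logit (orb n) =
  neg_logit x + a * (\sum_(0 <= k < n) orb k - n%:R * b).
Proof.
elim: n => [|n IH]; first by rewrite big_geq //= mul0r subrr mulr0 addr0.
rewrite [orb n.+1]iterS neg_logit_fab ?iter_fab_open01 // -/(orb n) IH.
by rewrite big_nat_recr //= -natr1; ring.
Qed.

(** The first term covers the starting point, the second the coordinate of [b], and the summand [a]
    the overshoot when a step crosses it. *)
Lemma neg_logit_iter_fab_bounded n : 0 < a -> 0 < b -> b < 1 ->
  `|neg_logit (orb n)| <= `|neg_logit x| + `|neg_logit b| + a.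
Proof.
move=> a0 b0 b1.
have nx := normr_ge0 (neg_logit x); have nb := normr_ge0 (neg_logit b).
elim: n => [|n IH]; first by rewrite /orb /=; lra.
rewrite [orb n.+1]iterS neg_logit_fab ?iter_fab_open01 // -/(orb n).
have /andP[z0 z1] := iter_fab_open01 n; move: IH; rewrite !ler_norml.
have := ler_norm (neg_logit b); have := lerNnormlW (lexx `|neg_logit b|).
(* Here the step lies in [[-a, 0]]: the upper bound is inherited, and the new value is at least
   [neg_logit b - a]. *)
have [zb|bz] := leP (orb n) b.
  have := neg_logit_le R _ _ z0 zb b1.
  move=> *; apply/andP; split; nra.
(* Symmetrically, the step lies in [[0, a]] and starts at most at [neg_logit b]. *)
have := neg_logit_le R _ _ b0 (ltW bz) z1.
move=> *; apply/andP; split; nra.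
Qed.

End orbit.

Theorem theorem3p4 (R : realType) (a b x : R)
    (ha : 0 < a) (hb0 : 0 < b) (hb1 : b < 1) (hx0 : 0 < x) (hx1 : x < 1) :
  (n%:R^-1 * \sum_(0 <= k < n) iter k (fab a b) x) @[n --> \oo] --> b.
Proof.
have x01 : 0 < x < 1 by rewrite hx0.
set y := neg_logit x.
(* The orbit bound plus the size of the initial coordinate, divided by [a]: a bound on
   [S - n.+1%:R * b], uniform in [n]. *)
pose C := (`|y| + `|neg_logit b| + a + `|y|) / a.
(* Passing to [n.+1] avoids the inverse of 0 and matches [harmonic n], which is [n.+1%:R^-1]. *)
rewrite -cvg_shiftS /=; apply/cvgrPdist_le => e e0.
have Ch : (fun n => C * harmonic n) @ \oo --> (0 : R).
  by rewrite -(mulr0 C); apply: cvgM; [exact: cvg_cst|exact: cvg_harmonic].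
move/cvgrPdist_le: Ch => /(_ e e0).
apply: filterS => n; rewrite sub0r normrN => /(le_trans (ler_norm _)).
apply: le_trans; rewrite /harmonic.
have /(congr1 (fun z => (z - y) / a)) := neg_logit_iter_fab R a b x x01 n.+1.
set S := \sum_(0 <= k < n.+1) _ => E.
have n0 : n.+1%:R != 0 :> R by rewrite pnatr_eq0.
have -> : b - n.+1%:R^-1 * S =
    - ((neg_logit (iter n.+1 (fab a b) x) - y) / a) / n.+1%:R.
  by rewrite E /y; field; rewrite nat1r n0 gt_eqF.
rewrite normrM normrN normfV (ger0_norm (ler0n _ _)).
rewrite ler_wpM2r ?invr_ge0 // normrM normfV (gtr0_norm ha).
rewrite ler_wpM2r ?invr_ge0 ?(ltW ha) // (le_trans (ler_normB _ _)) // lerD2r.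
exact: neg_logit_iter_fab_bounded.
Qed.
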